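(* Let $p$ be a prime and let $A_p$ be a countable (countably infinite) elementary abelian $p$-group. Then the endomorphism ring ${\rm End}(A_p)$ does not admit a nondiscrete locally compact ring topology.
   Context: An abelian group $A$ is an elementary abelian $p$-group if $pa=0$ for all $a\in A$ (equivalently, it is a direct sum of cyclic groups of order $p$, i.e. a vector space over $\mathbb F_p$). ${\rm End}(A)$ is the ring of all additive endomorphisms of $A$ under pointwise addition and composition. A ring topology on a ring is a topology for which addition, negation and multiplication are (jointly) continuous; all topologies considered are assumed completely regular, in particular Hausdorff. *)

(* Defs.v *)
From HB Require Import structures.
From mathcomp Require Import all_boot all_order all_algebra.
From mathcomp Require Import all_classical all_reals all_analysis.

Set Implicit Arguments.
Unset Strict Implicit.
Unset Printing Implicit Defensive.

Import GRing.Theory.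
Local Open Scope classical_set_scope.
Local Open Scope ring_scope.

Definition elementary_abelian (p : nat) (A : zmodType) :=
  forall a : A, a *+ p = 0.

Definition endo_ring (A : zmodType) : Type := {additive A -> A}.

Section EndoRing.
Variable A : zmodType.
Local Notation E := (endo_ring A).
Implicit Types f g h : E.

HB.instance Definition _ := gen_eqMixin E.
HB.instance Definition _ := gen_choiceMixin E.

Definition endo_fun f : A -> A := (f : {additive A -> A}).

Lemma endo_ext f g : endo_fun f =1 endo_fun g -> f = g.
Proof.
rewrite /endo_fun; case: f => [f [[mf]]]; case: g => [g [[mg]]] /= /funext fg.
by case: g / fg mg => mg; rewrite (Prop_irrelevance mf mg).
Qed.

Definition endo_zero : E := (\0 : A -> A) : {additive A -> A}.
Definition endo_one : E := (idfun : A -> A) : {additive A -> A}.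
Definition endo_opp f : E := (\- endo_fun f) : {additive A -> A}.
Definition endo_add f g : E :=
  (endo_fun f \+ endo_fun g) : {additive A -> A}.
Definition endo_mul f g : E :=
  (endo_fun f \o endo_fun g) : {additive A -> A}.

Lemma endo_addA : associative endo_add.
Proof. by move=> f g h; apply: endo_ext => x; exact: addrA. Qed.
Lemma endo_addC : commutative endo_add.
Proof. by move=> f g; apply: endo_ext => x; exact: addrC. Qed.
Lemma endo_add0 : left_id endo_zero endo_add.
Proof. by move=> f; apply: endo_ext => x; exact: add0r. Qed.
Lemma endo_addN : left_inverse endo_zero endo_opp endo_add.
Proof. by move=> f; apply: endo_ext => x; exact: addNr. Qed.

HB.instance Definition _ :=
  GRing.isZmodule.Build E endo_addA endo_addC endo_add0 endo_addN.

Lemma endo_mulA : associative endo_mul.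
Proof. by move=> f g h; apply: endo_ext. Qed.
Lemma endo_mul1l : left_id endo_one endo_mul.
Proof. by move=> f; apply: endo_ext. Qed.
Lemma endo_mul1r : right_id endo_one endo_mul.
Proof. by move=> f; apply: endo_ext. Qed.
Lemma endo_mulDl : left_distributive endo_mul endo_add.
Proof. by move=> f g h; apply: endo_ext. Qed.
Lemma endo_mulDr : right_distributive endo_mul endo_add.
Proof. by move=> f g h; apply: endo_ext => x; exact: raddfD. Qed.

HB.instance Definition _ := GRing.Zmodule_isPzRing.Build E
  endo_mulA endo_mul1l endo_mul1r endo_mulDl endo_mulDr.

End EndoRing.

(* A topology on [X] is a family of open sets, as in the library factory
   [isOpenTopological]; it is packed with the given choice structure of [X]. *)
Definition topology_on (X : choiceType) : Type :=
  isOpenTopological.axioms_ X (Choice.class X) (Choice.class X).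

Definition topologized (X : choiceType) (t : topology_on X) :
    topologicalType :=
  let t' : isOpenTopological.axioms_ X (Choice.class X) (Choice.class X) := t in
  HB.pack_for topologicalType X t'.

Section RingTopology.
Variables (R : pzRingType) (t : topology_on R).
Local Notation T := (topologized t).

Definition ring_topology : Prop :=
  [/\ continuous ((fun x => (x.1 : R) + (x.2 : R)) : T * T -> T),
      continuous ((fun x => - (x : R)) : T -> T) &
      continuous ((fun x => (x.1 : R) * (x.2 : R)) : T * T -> T)].

End RingTopology.

(* The condition [nbhs_principalE] defining [discreteTopologicalType]. *)
Definition discrete_space (T : topologicalType) : Prop :=
  @nbhs T T = principal_filter.

(* [completely_regular_space] is separation of points from closed sets by
   continuous real functions (see [uniform_separatorP]); it does not include
   the Hausdorff axiom. *)
Definition tychonoff_space (T : topologicalType) : Prop :=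
  completely_regular_space T /\ hausdorff_space T.

(* Main.v *)
Require Import Defs.
From HB Require Import structures.
From mathcomp Require Import all_boot all_order all_algebra.
From mathcomp Require Import all_classical all_reals all_analysis.

(** Give the endomorphism ring of [A] a locally compact Hausdorff ring topology;
it has to be shown discrete. Fix an injection [f] of [A] into [nat]: it serves
to enumerate [A], and to express finiteness of a subset of [A] by a bound on [f].

The topology refines pointwise convergence. For [v != 0] let [e] be an
endomorphism with image [<v>] fixing [v]. The fibres of the evaluation
[x |-> x v] are the fibres of the continuous map [x |-> x * e], so they are
closed. There are countably many of them, because [A] is countable, so by
Baire's theorem one has nonempty interior, and by translation all are open
([eval_locally_constant]).

Let [C] be a compact neighbourhood of [0]. Since evaluations are locally
constant, [C v] is finite for every [v], and every neighbourhood of [0] contains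
all the elements of [C] that vanish on a suitable finite set.

The elements of some neighbourhood of [0] all take their values in one finite
set ([images_bounded]). If not, there are [x_n] in [C], vanishing on the first
[n] elements of [A], and vectors [v_n] such that the [x_n v_n] are linearly
independent. Some endomorphism [r] sends each [x_n v_n] outside the finite set
[C v_n], so that no [r x_n] is in [C]; but left multiplication by [r] is
continuous, and every neighbourhood of [0] contains [x_n] for large [n].

Let then [S] be a finite set that contains all values of all elements of a
neighbourhood [D] of [0]. If some [w != 0] is a value of elements arbitrarily
close to [0], then for every [r] there is [x] close to [0] with [x v = w] and
[r x] in [D], whence [r w] is in [S]; this is absurd, since [r w] can be any
element of the infinite group [A]. So each nonzero element of the finite set [S]
is avoided by all values near [0], and near [0] there is only [0]: the topology
is discrete ([compact_ring_topology_discrete]).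

The endomorphisms used above extend additive maps given on a subgroup, by
Zorn's lemma ([partial_additive_extend]). *)

Set Implicit Arguments.
Unset Strict Implicit.
Unset Printing Implicit Defensive.
Import GRing.Theory.
Local Open Scope classical_set_scope.
Local Open Scope ring_scope.

(** * Extension of additive maps between elementary abelian groups *)

Section PartialAdditiveMaps.
Variables (p : nat) (A : zmodType).
Hypotheses (p_prime : prime p) (pA : elementary_abelian p A).
Implicit Types (G : set (A * A)) (w u x y : A) (k : nat).

(** The graphs of the additive maps defined on a subgroup of [A]. Closure under
opposite is automatic because the exponent [p] is positive. *)
Definition partial_additive G : Prop :=
  [/\ G 0,
      forall g h, G g -> G h -> G (g + h) &
      forall y, G (0, y) -> y = 0].

(** The graph of the extension sending [w] to [u], when [w] is outside the
domain of [G]. *)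
Definition adjoin G w u : set (A * A) :=
  [set g | exists h k, G h /\ g = h + (w, u) *+ k].

Lemma elementary_mod x k : x *+ k = x *+ (k %% p).
Proof. by rewrite {1}(divn_eq k p) mulrnDr mulnC mulrnA pA mul0rn add0r. Qed.

Lemma elementary_opp x : - x = x *+ p.-1.
Proof.
apply/eqP; rewrite eq_sym -addr_eq0 -mulrSr prednK ?prime_gt0 //.
by rewrite pA.
Qed.

Lemma pair_mulrn x y k : ((x, y) : A * A) *+ k = (x *+ k, y *+ k).
Proof. by elim: k => [|k IH]; rewrite ?mulr0n // !mulrS IH. Qed.

Lemma partial_additive_muln G g k : partial_additive G -> G g -> G (g *+ k).
Proof.
by move=> [G0 GD _] Gg; elim: k => [|k IH]; rewrite ?mulr0n // mulrS; apply: GD.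
Qed.

Lemma partial_additive_opp G g : partial_additive G -> G g -> G (- g).
Proof.
move=> Gp Gg; rewrite (_ : - g = g *+ p.-1); first exact: partial_additive_muln.
by case: g {Gg} => x y; rewrite pair_mulrn -!elementary_opp.
Qed.

Lemma partial_additive_inj G x y y' :
  partial_additive G -> G (x, y) -> G (x, y') -> y = y'.
Proof.
move=> Gp Gy Gy'; have [_ GD Gf] := Gp; apply/subr0_eq/Gf.
rewrite (_ : (0, y - y') = (x, y) - (x, y')).
  by apply: GD => //; exact: partial_additive_opp.
by rewrite -[RHS]/(_, _) subrr.
Qed.

Lemma sub_adjoin G w u : G `<=` adjoin G w u.
Proof. by move=> g Gg; exists g, 0; rewrite mulr0n addr0. Qed.

Lemma adjoin_new G w u : partial_additive G -> adjoin G w u (w, u).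
Proof. by move=> [G0 _ _]; exists 0, 1; rewrite mulr1n add0r. Qed.

(** If [k] is not a multiple of [p], it is invertible modulo [p], so [w] would
be in the domain of [G] as soon as [w *+ k] is; hence [x + w *+ k = 0] with [x]
in the domain forces [p] to divide [k]. *)
Lemma partial_additive_adjoin G w u : partial_additive G ->
  (forall y, ~ G (w, y)) -> partial_additive (adjoin G w u).
Proof.
move=> Gp Gw; have [G0 GD Gf] := Gp; split; first exact: sub_adjoin.
- move=> _ _ [g [k [Gg ->]]] [h [l [Gh ->]]].
  by exists (g + h), (k + l)%N; split; [exact: GD|rewrite mulrnDr addrACA].
- move=> y [[x z] [k [Gg]]]; rewrite pair_mulrn => -[/esym/eqP + ->].
  rewrite addr_eq0 => /eqP xE.
  have [pk|pk] := boolP (p %| k)%N.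
    move: Gg; rewrite xE (elementary_mod w) (elementary_mod u) (eqP pk).
    by rewrite !mulr0n oppr0 addr0 => /Gf.
  have cpk : coprime k p by rewrite coprime_sym prime_coprime.
  have k0 : (0 < k)%N by case: k pk {cpk xE} => //; rewrite dvdn0.
  have [a b ab _] := egcdnP p k0.
  (* Here [a * k] is [1] modulo [p], and [- x = w *+ k]. *)
  have : G (w, (- z) *+ a).
    suff -> : (w, (- z) *+ a) = (- (x, z)) *+ a.
      by apply: partial_additive_muln => //; exact: partial_additive_opp.
    rewrite {1}/GRing.opp /= pair_mulrn xE opprK -mulrnA mulnC ab.
    by rewrite (eqP cpk) mulrnDr mulnC mulrnA pA mul0rn add0r.
  by move/Gw.
Qed.

Lemma finite_adjoin G w u : finite_set G -> finite_set (adjoin G w u).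
Proof.
move=> finG.
apply: (@sub_finite_set _ _ ((fun q => q.1 + (w, u) *+ q.2) @` (G `*` `I_p))).
  move=> _ [g [k [Gg ->]]]; exists (g, k %% p)%N => /=.
    by split=> //=; rewrite ltn_pmod ?prime_gt0.
  by rewrite !pair_mulrn -!elementary_mod.
by apply/finite_image/finite_setX => //; exact: finite_II.
Qed.

(** Control of the range costs nothing, since a maximal extension is reached by
sending new vectors to [0]; it is what provides endomorphisms of rank one. *)
Lemma partial_additive_extend G : partial_additive G ->
  exists r : endo_ring A, (forall x y, G (x, y) -> endo_fun r x = y) /\
    forall x, exists x', G (x', endo_fun r x).
Proof.
move=> Gp.
pose range_in (H : set (A * A)) := forall g, H g -> exists x', G (x', g.2).
(* Zorn's lemma over unions of chains also considers the empty chain, whose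
   union [set0] has to be accepted. *)
pose good (H : set (A * A)) :=
  H = set0 \/ [/\ partial_additive H, G `<=` H & range_in H].
have [F chainF totF|H [goodH maxH]] := @Zorn_bigcup _ good.
  have [[H FH [h Hh]]|F0] := pselect (exists2 H, F H & H !=set0); last first.
    left; apply/seteqP; split=> // g [H FH Hg]; apply: F0; exists H => //.
    by exists g.
  have good_in K g : F K -> K g -> [/\ partial_additive K, G `<=` K & range_in K].
    by move=> /chainF [->|].
  have [[H0 HD Hf] GH _] := good_in _ _ FH Hh.
  right; split; last 1 first.
  - by move=> g [K FK Kg]; have [_ _] := good_in _ _ FK Kg; exact.
  - split; first by exists H.
      move=> g1 g2 [K1 FK1 Kg1] [K2 FK2 Kg2].
      have [[_ D1 _] _ _] := good_in _ _ FK1 Kg1.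
      have [[_ D2 _] _ _] := good_in _ _ FK2 Kg2.
      case: (totF _ _ FK1 FK2) => sK.
        by exists K2 => //; apply: D2 => //; exact: sK.
      by exists K1 => //; apply: D1 => //; exact: sK.
    by move=> y [K FK Ky]; have [[_ _ Kf] _ _] := good_in _ _ FK Ky; exact: Kf.
  - by move=> g Gg; exists H => //; exact: GH.
have {goodH} [Hp GH Hr] : [/\ partial_additive H, G `<=` H & range_in H].
  case: goodH => // H0; exfalso; apply: (maxH G); last first.
    by right; split=> // -[x y] Gg; exists x.
  by rewrite H0; split=> // /(_ 0); apply; have [] := Gp.
have total x : exists y, H (x, y).
  apply: contrapT => Hx.
  have {}Hx y : ~ H (x, y) by move=> Hxy; apply: Hx; exists y.
  have adp := partial_additive_adjoin 0 Hp Hx.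
  apply: (maxH (adjoin H x 0)); last first.
    right; split=> //; first by move=> g /GH; exact: sub_adjoin.
    move=> _ [[x1 y1] [k [Hg ->]]]; rewrite pair_mulrn /= mul0rn addr0.
    exact: Hr Hg.
  split; first exact: sub_adjoin.
  by move=> /(_ _ (adjoin_new _ _ Hp)) /Hx.
have [r Hr'] := choice total.
have r_nmod : nmod_morphism r.
  have [H0 HD _] := Hp; split; first exact: partial_additive_inj Hp (Hr' 0) H0.
  by move=> x y; apply: partial_additive_inj Hp (Hr' _) (HD _ _ (Hr' x) (Hr' y)).
pose ra := GRing.isNmodMorphism.Build A A r r_nmod.
pose r' : {additive A -> A} := HB.pack r ra.
exists (r' : endo_ring A); split=> [x y Gxy | x].
  exact: partial_additive_inj Hp (Hr' x) (GH _ Gxy).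
exact: Hr (Hr' x).
Qed.

Lemma partial_additive0 : partial_additive [set 0].
Proof. by split=> // [g h -> ->|y [->]] //; rewrite addr0. Qed.

Lemma rank_one_endo w u : w != 0 ->
  exists r : endo_ring A, endo_fun r w = u /\
    forall x, exists k, endo_fun r x = u *+ k.
Proof.
move=> w0; have ad := partial_additive_adjoin u partial_additive0.
have [|r [rE rr]] := partial_additive_extend (ad w _).
  by move=> y [/eqP]; rewrite (negPf w0).
exists r; split; first exact/rE/adjoin_new/partial_additive0.
move=> x; have [x' [_ [k [-> ]]]] := rr x.
by rewrite add0r pair_mulrn => -[_ ->]; exists k.
Qed.

End PartialAdditiveMaps.

(** * Topological preliminaries *)

Lemma endo_fun0 (A : zmodType) (x : endo_ring A) : endo_fun x 0 = 0.
Proof. exact: raddf0. Qed.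

Lemma endo_fun_muln (A : zmodType) (x : endo_ring A) v k :
  endo_fun x (v *+ k) = endo_fun x v *+ k.
Proof. exact: raddfMn. Qed.

(** Baire's theorem: if all [G n] had empty interior, one could choose a
decreasing sequence of nonempty open sets [U n] inside a compact set, with the
closure of [U n.+1] inside [U n] and disjoint from [G n]; a cluster point of
this sequence would be in no [G n]. *)
Lemma baire_countable_cover (T : topologicalType) (x0 : T) (G : nat -> set T) :
    hausdorff_space T -> locally_compact [set: T] ->
    (forall n, closed (G n)) -> (forall x, exists n, G n x) ->
  exists n, (G n)^° !=set0.
Proof.
move=> hT lcT closedG coverG; apply: contrapT => noint.
have nbhs_compact (x : T) : exists2 C, nbhs x C & compact C.
  have [C] := lcT x I; rewrite withinET => xC [cC _]; exists C => //.
have [C xC cC] := nbhs_compact x0.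
have regT (x : T) : {for x, regular_space T}.
  by have [K xK cK] := nbhs_compact x; exact: compact_regular cK xK.
pose goodset := {U : set T | open U /\ U !=set0}.
pose next (a b : nat * goodset) := b.1 = a.1.+1 /\
  closure (sval b.2) `<=` sval a.2 `&` ~` G a.1.
have next_ex a : {b | next a b}.
  apply/cid; case: a => n [U [oU U0]].
  have [x [Ux Gx]] : (U `&` ~` G n) !=set0.
    apply: contrapT => UG; apply: noint; exists n.
    case: U0 => x Ux; exists x; apply: (filterS _ (open_nbhs_nbhs (conj oU Ux))).
    by move=> y Uy; apply: contrapT => Gy; apply: UG; exists y.
  have [V xV VU] : filter_from (nbhs x) closure (U `&` ~` G n).
    apply: regT; apply: filterI; first exact: open_nbhs_nbhs.
    by apply: open_nbhs_nbhs; split=> //; exact/closed_openC.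
  have goodV : open V^° /\ V^° !=set0.
    by split; [exact: open_interior|exists x].
  exists (n.+1, exist _ V^° goodV); split=> //= y Vy; apply: VU.
  exact: (closure_subset (@interior_subset _ V)) Vy.
have goodC : open C^° /\ C^° !=set0.
  by split; [exact: open_interior|exists x0].
have [s [s0 sS]] := dependent_choice next_ex (0, exist _ C^° goodC : goodset).
have s1 n : (s n).1 = n.
  by elim: n => [|n IH]; [rewrite s0|have [-> _] := sS n; rewrite IH].
pose U n := sval (s n).2.
have UC : U 0 `<=` C by rewrite /U s0; exact: interior_subset.
have clU n : closure (U n.+1) `<=` U n `&` ~` G n.
  by have [_] := sS n; rewrite s1.
have UU m n : (m <= n)%N -> U n `<=` U m.
  elim: n => [|n IH]; first by rewrite leqn0 => /eqP ->.
  rewrite leq_eqVlt => /orP[/eqP -> //|/IH UnUm x Ux]; apply: UnUm.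
  by have [] := clU n x (subset_closure Ux).
pose F := filter_from [set: nat] U.
have FF : ProperFilter F.
  apply: filter_from_proper; last first.
    by move=> n _; rewrite /U; case: (s n).2 => V [].
  apply: filter_from_filter; first by exists 0.
  move=> i j _ _; exists (maxn i j) => // x Ux.
  by split; apply: UU Ux; rewrite ?leq_maxl ?leq_maxr.
have [|x [_ Fx]] := cC F FF; first by exists 0.
have [n Gnx] := coverG x.
have : closure (U n.+1) x.
  by move=> B /Fx; apply; exists n.+1.
by move=> /clU [_].
Qed.

Lemma continuous_left (T U V : topologicalType) (op : T * U -> V) (e : U) :
  continuous op -> continuous (fun x => op (x, e)).
Proof.
move=> cop x; apply: continuous_comp (cop (x, e)).
exact: (cvg_pair (@cvg_id _ (nbhs x)) (cvg_cst e)).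
Qed.

Lemma continuous_right (T U V : topologicalType) (op : T * U -> V) (e : T) :
  continuous op -> continuous (fun x => op (e, x)).
Proof.
move=> cop x; apply: continuous_comp (cop (e, x)).
exact: (cvg_pair (cvg_cst e) (@cvg_id _ (nbhs x))).
Qed.

(** * Locally compact ring topologies on the endomorphism ring *)

Section EndoTopology.
Variables (p : nat) (A : zmodType) (f : A -> nat).
Hypotheses (p_prime : prime p) (pA : elementary_abelian p A).
Hypotheses (f_inj : injective f) (A_infinite : infinite_set [set: A]).
Variable t : topology_on (endo_ring A).
Local Notation E := (endo_ring A).
Local Notation T := (topologized t).
Hypothesis ring_t : ring_topology t.
Hypothesis hausdorff_t : hausdorff_space T.
Hypothesis lc_t : locally_compact [set: T].
Local Notation "x @@ v" := (endo_fun (x : E) v) (at level 35).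
Local Notation zero := ((0 : E) : T).

Lemma mulr_continuous (e : E) : continuous ((fun x : E => x * e) : T -> T).
Proof.
have [_ _ mul_cont] := ring_t.
exact: (@continuous_left T T T (fun x => (x.1 : E) * (x.2 : E)) e mul_cont).
Qed.

Lemma mull_continuous (e : E) : continuous ((fun x : E => e * x) : T -> T).
Proof.
have [_ _ mul_cont] := ring_t.
exact: (@continuous_right T T T (fun x => (x.1 : E) * (x.2 : E)) e mul_cont).
Qed.

Lemma addr_continuous (e : E) : continuous ((fun x : E => x + e) : T -> T).
Proof.
have [add_cont _ _] := ring_t.
exact: (@continuous_left T T T (fun x => (x.1 : E) + (x.2 : E)) e add_cont).
Qed.

(** For [e] with image [<v>] and [e v = v], and [y] in the fibre, the equations
[x v = w] and [x * e = y * e] are equivalent. *)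
Lemma fibre_closed v w : v != 0 -> closed [set x : T | x @@ v = w].
Proof.
move=> v0.
have [[y yv]|ney] := pselect (exists y : E, y @@ v = w); last first.
  rewrite (_ : mkset _ = set0); first exact: closed0.
  by apply/seteqP; split=> // x xv; apply: ney; exists x.
have [e [ev er]] := rank_one_endo p_prime pA v v0.
rewrite (_ : mkset _ = ((fun x : E => x * e) : T -> T) @^-1` [set (y * e : E)]).
  apply: closed_comp => [x _|]; first exact: mulr_continuous.
  exact/accessible_closed_set1/hausdorff_accessible.
apply/seteqP; split=> x /=.
  move=> xv; apply: endo_ext => a; have [k eE] := er a.
  by change (x @@ (e @@ a) = y @@ (e @@ a)); rewrite eE !endo_fun_muln xv yv.
move=> /(congr1 (fun z : E => z @@ v)).
by change (x @@ (e @@ v) = y @@ (e @@ v) -> x @@ v = w); rewrite ev yv.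
Qed.

(** Some fibre of the evaluation at [v] has nonempty interior by Baire's theorem,
and any two fibres are translates of each other. *)
Lemma eval_locally_constant v (z : E) :
  \forall x \near (z : T), x @@ v = z @@ v.
Proof.
have [-> | v0] := eqVneq v 0.
  by apply: (@nearW _ (nbhs (z : T))) => x; rewrite !endo_fun0.
pose G n := [set x : T | f (x @@ v) = n].
have [n|x|n [y Gy]] := @baire_countable_cover T zero G hausdorff_t lc_t.
- have [[w fw]|nw] := pselect (exists w, f w = n).
    rewrite (_ : G n = [set x : T | x @@ v = w]); first exact: fibre_closed.
    by rewrite /G -fw; apply/seteqP; split=> x /= => [/f_inj|->].
  rewrite (_ : G n = set0); first exact: closed0.
  by apply/seteqP; split=> // x xv; apply: nw; exists (x @@ v).
- by exists (f (x @@ v)).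
have Gyy : f (y @@ v) = n := nbhs_singleton Gy.
have Gzy : nbhs (z + ((y : E) - z) : T) (G n) by rewrite addrC subrK.
apply: (@filterS _ (nbhs (z : T)) _ _ _ _ (addr_continuous Gzy)) => x /= Gx.
have : (x : E) @@ v + (y @@ v - z @@ v) = y @@ v by apply: f_inj; rewrite Gyy.
by move=> /eqP; rewrite addrCA -subr_eq0 addrAC subrr add0r subr_eq0 => /eqP.
Qed.

(** A neighbourhood filter is stable under finite intersections, here indexed
by the finite set of the [w] with [f w < n]. *)
Lemma near_below (P : A -> set T) n (z : T) :
  (forall w, \forall x \near z, P w x) ->
  \forall x \near z, forall w, (f w < n)%N -> P w x.
Proof.
move=> nearP; elim: n => [|n IH].
  by apply: (@nearW _ (nbhs z)) => x w; rewrite ltn0.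
have [[w fw]|nw] := pselect (exists w, f w = n).
  apply: filterS2 (nearP w) IH => x Pw Px w'.
  by rewrite ltnS leq_eqVlt => /orP[/eqP|/Px //]; rewrite -fw => /f_inj ->.
apply: filterS IH => x Px w; rewrite ltnS leq_eqVlt => /orP[/eqP fw|/Px //].
by case: nw; exists w.
Qed.

Lemma exists_above m : exists u, (m <= f u)%N.
Proof.
apply: contrapT => nu; apply: A_infinite.
apply: (@sub_finite_set _ _ (f @^-1` `I_m)).
  by move=> u _; rewrite /= ltnNge; apply/negP => fu; apply: nu; exists u.
by apply: finite_preimage; [move=> ? ? _ _; exact: f_inj|exact: finite_II].
Qed.

Variable C : set T.
Hypothesis compactC : compact C.
Hypothesis nbhsC : nbhs zero C.

(** A locally constant function has a finite image on a compact set. *)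
Lemma compact_bounded_at v : exists m, forall x, C x -> (f (x @@ v) < m)%N.
Proof.
have cC : near_covering C by exact/compact_near_coveringP.
have := cC nat \oo (fun m x => (f (x @@ v) < m)%N) _.
case=> [x _|m _ Cm]; last by exists m; exact: (Cm m (leqnn m)).
exists ([set y : T | y @@ v = x @@ v], [set m | f (x @@ v) < m]%N).
  by split; [exact: eval_locally_constant|exists (f (x @@ v)).+1].
by move=> [y m] /= [-> ].
Qed.

Definition kills n (x : E) := forall v, (f v < n)%N -> x @@ v = 0.

Lemma near_kills n : \forall x \near zero, kills n x.
Proof. by apply: near_below => w; exact: eval_locally_constant. Qed.

(** On a compact set the topology coincides with pointwise convergence: every
point of [C] other than [0] has a neighbourhood on which some evaluation is a
nonzero constant. *)
Lemma compact_kills_small (O : set T) :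
  nbhs zero O -> exists n, forall x, C x -> kills n x -> O x.
Proof.
move=> zO; have cC : near_covering C by exact/compact_near_coveringP.
have := cC nat \oo (fun n x => kills n x -> O x) _.
case=> [x _|m _ Cm]; last by exists m; exact: (Cm m (leqnn m)).
have [-> | /eqP x0] := eqVneq x zero.
  by exists (O, setT) => [|[y m] []] //; split=> //; exact: filterT.
have [v xv] : exists v, x @@ v != 0.
  apply: contrapT => xv; apply: x0; apply: endo_ext => v; apply/eqP.
  by apply: contrapT => /negP xv0; apply: xv; exists v.
exists ([set y : T | y @@ v = x @@ v], [set m | f v < m]%N).
  by split; [exact: eval_locally_constant|exists (f v).+1].
by move=> [y m] /= [yv vm] /(_ v vm) /eqP; rewrite yv (negPf xv).
Qed.

(** Otherwise a diagonal construction yields an endomorphism [r] for which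
left multiplication is discontinuous at [0]: a growing sequence of finite
partial maps prescribes [r (x_n v_n)] outside [C v_n], where [x_n] in [C] kills
the first [n] elements, and [x_n v_n] is chosen outside the current domain. *)
Lemma images_bounded : exists n m, forall x, C x -> kills n x ->
  forall v, (f (x @@ v) < m)%N.
Proof.
apply: contrapT => unb.
have {}unb n m : exists x v, [/\ C x, kills n x & (m <= f (x @@ v))%N].
  apply: contrapT => nx; apply: unb; exists n, m => x Cx kx v.
  by rewrite ltnNge; apply/negP => mf; apply: nx; exists x, v.
pose state := {G : set (A * A) | partial_additive G /\ finite_set G}.
pose next (a b : nat * state) := [/\ b.1 = a.1.+1, sval a.2 `<=` sval b.2 &
  exists x v u, [/\ C x, kills a.1 x, sval b.2 (x @@ v, u) &
    forall y, C y -> y @@ v <> u]].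
have next_ex a : {b | next a b}.
  apply/cid; case: a => n [G [Gp Gfin]].
  have [m Gm] : exists m, forall w y, G (w, y) -> (f w < m)%N.
    have /finite_seqP[e Ge] := Gfin.
    exists (\max_(g <- e) f g.1).+1 => w y; rewrite Ge /= ltnS => wy.
    exact: (@leq_bigmax_seq _ e xpredT (fun g => f g.1) (w, y)).
  have [x [v [Cx kx mx]]] := unb n m.
  have [l Cl] := compact_bounded_at v; have [u lu] := exists_above l.
  have Gp' : partial_additive (adjoin G (x @@ v) u).
    by apply: (partial_additive_adjoin p_prime pA) => // y /Gm; rewrite ltnNge mx.
  have Gfin' := finite_adjoin p_prime pA (x @@ v) u Gfin.
  exists (n.+1, exist _ (adjoin G (x @@ v) u) (conj Gp' Gfin')).
  split=> //=; first exact: sub_adjoin.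
  exists x, v, u; split=> //; first exact: adjoin_new.
  by move=> y /Cl + yu; rewrite yu ltnNge lu.
have fin0 : partial_additive [set (0 : A * A)] /\ finite_set [set (0 : A * A)].
  by split; [exact: partial_additive0|exact: finite_set1].
have [s [s0 sS]] := dependent_choice next_ex (0, exist _ _ fin0 : state).
have s1 n : (s n).1 = n.
  by elim: n => [|n IH]; [rewrite s0|have [-> _ _] := sS n; rewrite IH].
pose G n := sval (s n).2.
have GG m n : (m <= n)%N -> G m `<=` G n.
  elim: n => [|n IH]; first by rewrite leqn0 => /eqP ->.
  rewrite leq_eqVlt => /orP[/eqP -> //|/IH GmGn x /GmGn].
  by have [_ + _] := sS n; exact.
have Gp n : partial_additive (G n) by rewrite /G; case: (s n).2 => ? [].
have Up : partial_additive (\bigcup_n G n).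
  split; first by exists 0 => //; have [] := Gp 0.
    move=> g h [i _ Gg] [j _ Gh]; exists (maxn i j) => //.
    have [_ GD _] := Gp (maxn i j).
    by apply: GD; [apply: GG Gg|apply: GG Gh]; rewrite ?leq_maxl ?leq_maxr.
  by move=> y [n _ Gy]; have [_ _ Gf] := Gp n; exact: Gf.
have [r [rE _]] := partial_additive_extend p_prime pA Up.
have [n Cn] : exists n, forall x, C x -> kills n x -> C (r * (x : E)).
  apply: compact_kills_small; apply: mull_continuous.
  by rewrite mulr0.
have [_ _ [x [v [u [Cx]]]]] := sS n; rewrite s1 => kx Gxv Cu.
apply: (Cu _ (Cn _ Cx kx)); apply: (rE (x @@ v)).
by exists n.+1.
Qed.

(** If [w != 0] is a value of endomorphisms arbitrarily close to [0], then so is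
[r w] for all [r], whereas [r w] ranges over the infinite group [A] and values
near [0] are in a finite set. *)
Lemma compact_ring_topology_discrete : discrete_space T.
Proof.
have [n [m Dm]] := images_bounded.
have nearD : \forall x \near zero, C x /\ kills n x.
  by apply: filterI => //; exact: near_kills.
have [small|] := pselect (forall w, w != 0 ->
    \forall x \near zero, forall v, x @@ v <> w); last first.
  move=> /existsNP [w /not_implyP [w0 freq]]; exfalso.
  have [u mu] := exists_above m.
  have [r [rw _]] := rank_one_endo p_prime pA u w0.
  apply: freq.
  have : \forall x \near zero, C (r * (x : E)) /\ kills n (r * (x : E)).
    apply: (@mull_continuous r zero (fun y => C y /\ kills n y)).
    by rewrite mulr0.
  apply: filterS => x [Crx krx] v xv.
  have := Dm _ Crx krx v.
  by change ((f (r @@ (x @@ v)) < m)%N -> False); rewrite xv rw ltnNge mu.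
have near0 : \forall x \near zero, x = zero.
  have small' w : \forall x \near zero, w != 0 -> forall v, x @@ v <> w.
    have [-> |w0] := eqVneq w 0; first by apply: (@nearW _ (nbhs zero)).
    by apply: (@filterS _ (nbhs zero) _ _ _ _ (small w w0)).
  apply: filterS2 nearD (near_below m small') => x [Cx kx] xm.
  apply: endo_ext => v; apply/eqP/negPn/negP => xv.
  exact: (xm _ (Dm _ Cx kx v) xv v).
rewrite /discrete_space; apply/funext => z; apply/seteqP; split => B.
  move=> zB _ ->; exact: nbhs_singleton zB.
move=> Bz.
have near_subrr : nbhs ((z : E) - (z : E) : T) [set zero] by rewrite subrr.
apply: (@filterS _ (nbhs z) _ _ _ _ (addr_continuous near_subrr)) => x /= xz.
by apply: Bz; apply/subr0_eq.
Qed.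

End EndoTopology.

Theorem theorem3 (p : nat) (A : zmodType) (hp : prime p)
    (hA : elementary_abelian p A)
    (A_countable : countable [set: A]) (A_infinite : infinite_set [set: A]) :
  ~ exists t : topology_on (endo_ring A),
      [/\ ring_topology t,
          tychonoff_space (topologized t),
          locally_compact [set: topologized t] &
          ~ discrete_space (topologized t)].
Proof.
move=> [t [ring_t [_ hausdorff_t] lc_t]]; apply.
have [f f_injT] := countable_injP _ A_countable.
have f_inj : injective f by move=> x y; apply: f_injT; rewrite inE.
have [C] := lc_t ((0 : endo_ring A) : topologized t) I.
rewrite withinET => zC [cC _].
exact: (compact_ring_topology_discrete hp hA f_inj A_infinite ring_t hausdorff_t
  lc_t cC zC).
Qed.
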